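(* Let $\star\in\{\mathrm{TE},\mathrm{TH}\}$, where the case $\star=\mathrm{TH}$ is considered only when $m$ is even. Let $C,D\leq KG$ be projector additive left group codes, and write $C=\operatorname{Im}(P)$ and $D=\operatorname{Im}(Q)$, where $P,Q\in\operatorname{End}_{FG}(KG)$ are $FG$-linear projectors. Then the following are equivalent: (1) $C\cong D$ as left $FG$-modules. (2) $P\sim_{\mathrm{MvN}}Q$ in $\operatorname{End}_{FG}(KG)$. (3) $\ker(P)^{\perp_\star}\cong\ker(Q)^{\perp_\star}$ as left $FG$-modules.
   Context: $F=\mathbb{F}_q$ is a finite field, $K=\mathbb{F}_{q^m}$ is its extension of degree $m$, $G$ is a finite group, and $FG\subseteq KG$ are the group algebras; $KG$ is viewed as a left $FG$-module. An additive left group code is a left $FG$-submodule of $KG$. An $FG$-linear projector is an element $P\in\operatorname{End}_{FG}(KG)$ with $P^2=P$; a projector additive left group code is a code of the form $\operatorname{Im}(P)$ for an $FG$-linear projector $P$. Idempotents $e,f$ of a ring $A$ are Murray--von Neumann equivalent, written $e\sim_{\mathrm{MvN}}f$, if there exist $a,b\in A$ with $e=ba$ and $f=ab$. For $x=\sum_{g\in G}a_g g$ and $y=\sum_{g\in G}b_g g$ in $KG$, $\langle x,y\rangle_{\mathrm{TE}}=\operatorname{Tr}_{K/F}\left(\sum_{g\in G}a_gb_g\right)$ and, when $m$ is even, $\langle x,y\rangle_{\mathrm{TH}}=\operatorname{Tr}_{K/F}\left(\sum_{g\in G}a_g\overline{b_g}\right)$, where $\overline{b}=b^{q^{m/2}}$.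 For $W\leq KG$, $W^{\perp_\star}=\{x\in KG:\langle x,w\rangle_\star=0\text{ for all }w\in W\}$. *)

(* Defs.v *)
From HB Require Import structures.
From mathcomp Require Import all_boot all_order all_algebra all_fingroup all_field.
From mathcomp Require Import boolp classical_sets functions.

Set Implicit Arguments.
Unset Strict Implicit.
Unset Printing Implicit Defensive.

Import GRing.Theory.
Local Open Scope ring_scope.

(* [finfun] already carries the pointwise product, hence the alias. *)
Definition grpalg (R : nzRingType) (gT : finGroupType) := {ffun gT -> R}.

Section GroupAlgebra.
Variables (R : nzRingType) (gT : finGroupType).
Local Notation A := (grpalg R gT).

HB.instance Definition _ := GRing.Zmodule.copy A {ffun gT -> R}.

Definition grpalg_one : A := [ffun g => (g == 1%g)%:R].
Definition grpalg_mul (x y : A) : A := [ffun g => \sum_h x h * y (h^-1 * g)%g].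

Fact grpalg_mulA : associative grpalg_mul.
Proof.
move=> x y z; apply/ffunP=> g; rewrite !ffunE.
under eq_bigr => h _ do rewrite ffunE mulr_sumr.
under [RHS]eq_bigr => h _ do rewrite ffunE mulr_suml.
rewrite [RHS]exchange_big; apply: eq_bigr => h _ /=.
rewrite [RHS](reindex_inj (mulgI h)); apply: eq_bigr => k _ /=.
by rewrite mulKg invMg mulrA !mulgA.
Qed.

Fact grpalg_mul1 : left_id grpalg_one grpalg_mul.
Proof.
move=> x; apply/ffunP=> g; rewrite ffunE (bigD1 1%g) //= ffunE eqxx mul1r.
by rewrite invg1 mul1g big1 ?addr0 // => h /negPf nh; rewrite ffunE nh mul0r.
Qed.

Fact grpalg_mulr1 : right_id grpalg_one grpalg_mul.
Proof.
move=> x; apply/ffunP=> g; rewrite ffunE (bigD1 g) //= ffunE mulVg eqxx mulr1.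
rewrite big1 ?addr0 // => h nh; rewrite ffunE -eq_mulVg1.
by rewrite (negPf nh) mulr0.
Qed.

Fact grpalg_mulDl : left_distributive grpalg_mul +%R.
Proof.
move=> x y z; apply/ffunP=> g; rewrite !ffunE -big_split; apply: eq_bigr => h _.
by rewrite ffunE mulrDl.
Qed.

Fact grpalg_mulDr : right_distributive grpalg_mul +%R.
Proof.
move=> x y z; apply/ffunP=> g; rewrite !ffunE -big_split; apply: eq_bigr => h _.
by rewrite ffunE mulrDr.
Qed.

Fact grpalg_oner_neq0 : grpalg_one != 0 :> A.
Proof.
by apply/eqP=> /ffunP/(_ 1%g)/eqP; rewrite !ffunE eqxx oner_eq0.
Qed.

HB.instance Definition _ := GRing.Zmodule_isNzRing.Build A
  grpalg_mulA grpalg_mul1 grpalg_mulr1 grpalg_mulDl grpalg_mulDr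
  grpalg_oner_neq0.

End GroupAlgebra.

Section ExtensionModule.
Variables (F : fieldType) (K : fieldExtType F) (gT : finGroupType).

Definition grpalg_incl (a : grpalg F gT) : grpalg K gT := [ffun g => (a g)%:A].

Definition grpalg_scale (a : grpalg F gT) (x : grpalg K gT) : grpalg K gT :=
  grpalg_incl a * x.

Fact grpalg_scaleA a b x :
  grpalg_scale a (grpalg_scale b x) = grpalg_scale (a * b) x.
Proof.
rewrite /grpalg_scale mulrA; congr (_ * _); apply/ffunP=> g; rewrite !ffunE.
rewrite scaler_suml; apply: eq_bigr => h _.
by rewrite !ffunE -scalerAl mul1r scalerA.
Qed.

Fact grpalg_scale1 : left_id 1 grpalg_scale.
Proof.
move=> x; rewrite /grpalg_scale -[RHS]mul1r; congr (_ * _).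
by apply/ffunP=> g; rewrite !ffunE scaler_nat.
Qed.

Fact grpalg_scaleDr : right_distributive grpalg_scale +%R.
Proof. by move=> a x y; rewrite /grpalg_scale mulrDr. Qed.

Fact grpalg_scaleDl x : {morph grpalg_scale^~ x : a b / a + b}.
Proof.
move=> a b; rewrite /grpalg_scale -mulrDl; congr (_ * _).
by apply/ffunP=> g; rewrite !ffunE scalerDl.
Qed.

HB.instance Definition _ := GRing.Zmodule_isLmodule.Build (grpalg F gT)
  (grpalg K gT) grpalg_scaleA grpalg_scale1 grpalg_scaleDr grpalg_scaleDl.

End ExtensionModule.

Definition lend (R : pzRingType) (V : lmodType R) := {linear V -> V}.

Section EndomorphismRing.
Variables (R : pzRingType) (V : lmodType R).
Local Notation E := (lend V).

Lemma lendP (f g : E) : f =1 g <-> f = g.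
Proof.
split=> [|-> //]; case: f g => [f [[[f0 fA]] [fZ]]] [g [[[g0 gA]] [gZ]]] /=.
move=> /funext fg; case: g / fg g0 gA gZ => g0 gA gZ.
by rewrite (Prop_irrelevance f0 g0) (Prop_irrelevance fA gA)
           (Prop_irrelevance fZ gZ).
Qed.

HB.instance Definition _ := gen_eqMixin E.
HB.instance Definition _ := gen_choiceMixin E.

Definition lend_zero : E := \0.
Definition lend_opp (f : E) : E := \- f.
Definition lend_add (f g : E) : E := f \+ g.
Definition lend_one : E := idfun.
Definition lend_mul (f g : E) : E := f \o g.

Fact lend_addA : associative lend_add.
Proof. by move=> f g h; apply/lendP=> x /=; rewrite addrA. Qed.
Fact lend_addC : commutative lend_add.
Proof. by move=> f g; apply/lendP=> x /=; rewrite addrC. Qed.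
Fact lend_add0 : left_id lend_zero lend_add.
Proof. by move=> f; apply/lendP=> x /=; rewrite add0r. Qed.
Fact lend_addN : left_inverse lend_zero lend_opp lend_add.
Proof. by move=> f; apply/lendP=> x /=; rewrite addNr. Qed.

HB.instance Definition _ :=
  GRing.isZmodule.Build E lend_addA lend_addC lend_add0 lend_addN.

Fact lend_mulA : associative lend_mul.
Proof. by move=> f g h; apply/lendP. Qed.
Fact lend_mul1 : left_id lend_one lend_mul.
Proof. by move=> f; apply/lendP. Qed.
Fact lend_mulr1 : right_id lend_one lend_mul.
Proof. by move=> f; apply/lendP. Qed.
Fact lend_mulDl : left_distributive lend_mul +%R.
Proof. by move=> f g h; apply/lendP. Qed.
Fact lend_mulDr : right_distributive lend_mul +%R.
Proof. by move=> f g h; apply/lendP=> x /=; rewrite raddfD. Qed.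

HB.instance Definition _ := GRing.Zmodule_isPzRing.Build E
  lend_mulA lend_mul1 lend_mulr1 lend_mulDl lend_mulDr.

End EndomorphismRing.

Definition mvn_equiv (A : pzRingType) (e f : A) : Prop :=
  exists a b : A, e = b * a /\ f = a * b.

Local Open Scope classical_set_scope.

Section Submodules.
Variables (R : pzRingType) (V : lmodType R).

Definition is_submod (C : set V) : Prop :=
  C 0 /\ forall a x y, C x -> C y -> C (a *: x + y).

Definition kernel (P : lend V) : set V := [set x | P x = 0].

Fact range_submod (P : lend V) : is_submod (range P).
Proof.
split=> [|a _ _ [x _ <-] [y _ <-]]; first by exists 0; rewrite ?linear0.
by exists (a *: x + y); rewrite // linearP.
Qed.

Fact kernel_submod (P : lend V) : is_submod (kernel P).
Proof.
split=> [|a x y]; rewrite /kernel /= ?linear0 // linearP => -> ->.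
by rewrite scaler0 addr0.
Qed.

(* Isomorphism of the submodules C and D; only the restriction of f to C
   matters. *)
Definition submod_iso (C D : set V) : Prop :=
  exists f : V -> V, set_bij C D f /\
    forall a x y, C x -> C y -> f (a *: x + y) = a *: f x + f y.

End Submodules.

Inductive duality := TE | TH.

Lemma galTraceZ (F : fieldType) (L : splittingFieldType F) (U V : {vspace L})
    (c : F) (a : L) :
  galTrace U V (c *: a) = c *: galTrace U V a.
Proof.
by rewrite /galTrace scaler_sumr; apply: eq_bigr => u _; rewrite linearZ.
Qed.

Section TraceForms.
Variables (F : finFieldType) (K : fieldExtType F) (gT : finGroupType).
Local Notation KG := (grpalg K gT).

(* A finite extension of a finite field is always a splitting field, so the
   Galois trace makes sense on any K; its values lie in the copy 1%VS of F
   inside K. *)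
Definition fieldTr (a : K) : K :=
  @galTrace F (FinSplittingFieldType F K) 1%VS fullv a.

Definition fbar (b : K) : K := b ^+ (#|F| ^ (\dim {:K})./2).

Definition trform (s : duality) (x y : KG) : K :=
  match s with
  | TE => fieldTr (\sum_(g : gT) x g * y g)
  | TH => fieldTr (\sum_(g : gT) x g * fbar (y g))
  end.

Definition perp (s : duality) (W : set KG) : set KG :=
  [set x | forall w, W w -> trform s x w = 0].

Let L := FinSplittingFieldType F K.

Fact fieldTr_is_zmod_morphism : zmod_morphism fieldTr.
Proof. exact: (@raddfB _ _ (@galTrace F L 1%VS fullv)). Qed.
HB.instance Definition _ :=
  GRing.isZmodMorphism.Build K K fieldTr fieldTr_is_zmod_morphism.

Fact fieldTrZ c a : fieldTr (c *: a) = c *: fieldTr a.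
Proof. exact: (@galTraceZ F L). Qed.

Lemma fieldTr_in_base a : fieldTr a \in (1%VS : {vspace K}).
Proof.
apply: (@mem_galTrace F L 1%AS {:L}%AS); last exact: memvf.
by apply: finField_galois; apply: sub1v.
Qed.

Lemma trformE s x y : trform s x y =
  fieldTr (\sum_(g : gT) x g * (if s is TH then fbar (y g) else y g)).
Proof. by case: s. Qed.

Fact perp_submod s W : @is_submod (grpalg F gT) KG W ->
  @is_submod (grpalg F gT) KG (perp s W).
Proof.
case=> W0 WP; split=> [w _|a x y Wx Wy w Ww].
  by rewrite trformE big1 ?raddf0 // => g _; rewrite ffunE mul0r.
have WZ (b : grpalg F gT) z : W z -> W (b *: z).
  by move=> Wz; rewrite -[_ *: _]addr0; apply: WP.
pose d h : grpalg F gT := [ffun g => (g == h)%:R].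
have dE h z g : (d h *: z : KG) g = z (h^-1 * g)%g.
  rewrite ffunE (bigD1 h) //= !ffunE eqxx scale1r mul1r big1 ?addr0 // => k nk.
  by rewrite !ffunE (negPf nk) scale0r mul0r.
have aE g : (a *: x : KG) g = \sum_h a h *: x (h^-1 * g)%g.
  rewrite ffunE; apply: eq_bigr => h _.
  by rewrite ffunE -scalerAl mul1r.
rewrite trformE.
under eq_bigr => g _ do rewrite ffunE mulrDl aE mulr_suml.
rewrite big_split /= raddfD /= exchange_big /= -[X in _ + X]trformE (Wy _ Ww).
rewrite addr0 raddf_sum big1 //= => h _.
under eq_bigr => g _ do rewrite -scalerAl.
rewrite -scaler_sumr fieldTrZ (reindex_inj (mulgI h)) /=.
have Tw := Wx _ (WZ (d h^-1%g) _ Ww); rewrite trformE in Tw.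
transitivity (a h *: (0 : K)); last by rewrite scaler0.
rewrite -[in RHS]Tw.
congr (_ *: fieldTr _); apply: eq_bigr => g _.
by rewrite mulKg dE invgK.
Qed.

End TraceForms.

(* Main.v *)
From HB Require Import structures.
Require Import Defs.
From mathcomp Require Import all_boot all_order all_algebra all_fingroup all_field.
From mathcomp Require Import boolp classical_sets functions.

Import GRing.Theory.
Local Open Scope ring_scope.
Local Open Scope classical_set_scope.

(* Murray-von Neumann equivalence of idempotent endomorphisms is isomorphism of
   their images.  The trace form is symmetric, nondegenerate and G-invariant,
   so every P has an FG-linear adjoint P^*; taking adjoints is an
   anti-automorphism of End_FG(KG), hence preserves Murray-von Neumann
   equivalence in both directions, and ker(P)^perp is the image of P^*. *)

(** * Idempotent endomorphisms and their images *)

Section Linear.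
Context {R : pzRingType} {V : lmodType R}.

Lemma linear_lend (f : V -> V) : linear f -> exists L : lend V, L =1 f.
Proof.
move=> lf.
by exists (HB.pack_for (@lend R V) f (GRing.isLinear.Build R V V *:%R f lf)).
Qed.

Lemma idem_range (P : lend V) : P ^+ 2 = P ->
  forall x, range P x <-> P x = x.
Proof.
move=> PP x; split=> [[y _ <-]|<-]; last by exists x.
by rewrite -[in RHS]PP.
Qed.

Lemma submod_iso_mvn (P Q : lend V) : P ^+ 2 = P -> Q ^+ 2 = Q ->
  submod_iso (range P) (range Q) <-> mvn_equiv P Q.
Proof.
move=> PP QQ; have rP := idem_range _ PP; have rQ := idem_range _ QQ.
have rPx x : range P (P x) by exists x.
have rQx x : range Q (Q x) by exists x.
split=> [[f [[fPQ fI fS] flin]]|[a [b [Pba Qab]]]].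
  (* [h] is [Q] followed by the inverse of [f]; it becomes [b], while [a] is [P] followed by [f]. *)
  have /choice[h hE] : forall y, exists x, range P x /\ f x = Q y.
    by move=> y; have [x Px <-] := fS _ (rQx y); exists x.
  have hP y : P (h y) = h y by apply/rP; case: (hE y).
  have hf y : f (h y) = Q y by case: (hE y).
  have fQ x : Q (f (P x)) = f (P x) by apply/rQ/fPQ/rPx.
  have [a aE] : exists a : lend V, a =1 (fun x => f (P x)).
    by apply: linear_lend => c x y; rewrite linearP flin.
  have [b bE] : exists b : lend V, b =1 h.
    (* Linearity of [h] is tested after applying [f], which is injective on [range P]. *)
    apply: linear_lend => c x y; apply: fI; rewrite ?inE.
    - by rewrite -hP.
    - by rewrite -[h x]hP -[h y]hP -linearP.
    by rewrite flin ?hf ?linearP // -hP.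
  exists a, b; split; apply/lendP => x /=.
    change (P x = b (a x)); rewrite aE bE; apply: fI; rewrite ?inE //.
      by rewrite -hP.
    by rewrite hf fQ.
  by change (Q x = a (b x)); rewrite bE aE hP hf.
have baE x : b (a x) = P x by rewrite Pba.
have abE x : a (b x) = Q x by rewrite Qab.
(* Between the two images, [a] is inverted by [b]. *)
exists a; split=> [|c x y _ _]; last exact: linearP.
split=> [x /rP Px|x y|y /rQ Qy].
- by apply/rQ; rewrite -abE baE Px.
- by rewrite !inE => /rP Px /rP Py axy; rewrite -Px -baE axy baE.
by exists (b y); [apply/rP; rewrite -baE abE Qy | rewrite abE].
Qed.

End Linear.

(** * Adjoints for a symmetric nondegenerate form *)

Section Adjoint.
Context {R : pzRingType} {V : lmodType R} {W : zmodType}.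
Variables (B : V -> V -> W) (star : R -> R).
Hypothesis BD : forall x y z, B (x + y) z = B x z + B y z.
Hypothesis Bsym : forall x y, B x y = B y x.
Hypothesis Bnd : forall x, (forall y, B x y = 0) -> x = 0.
Hypothesis Bstar : forall a x y, B (a *: x) y = B x (star a *: y).
Hypothesis Badj : forall (P : lend V) x, exists z, forall y, B z y = B x (P y).

Lemma form_subr x y z : B (x - y) z = B x z - B y z.
Proof. by apply/eqP; rewrite eq_sym subr_eq -BD subrK. Qed.

Lemma form_inj x y : (forall z, B x z = B y z) -> x = y.
Proof.
move=> xy; apply/eqP; rewrite -subr_eq0; apply/eqP/Bnd => z.
by rewrite form_subr xy subrr.
Qed.

(** [Badj] supplies a value at each point; nondegeneracy makes it unique, and moving scalars across
    [B] by [star] then forces linearity. *)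
Lemma adjointP :
  exists adj : lend V -> lend V, forall P x y, B (adj P x) y = B x (P y).
Proof.
suff /choice[adj adjE] : forall P : lend V,
    exists P' : lend V, forall x y, B (P' x) y = B x (P y) by exists adj.
move=> P; have /choice[f fE] := Badj P.
have [|P' P'E] := @linear_lend _ _ f; last first.
  by exists P' => x y; rewrite P'E.
move=> a x y; apply: form_inj => z.
by rewrite fE !BD !Bstar !fE linearZ.
Qed.

Definition form_perp (C : set V) : set V := [set x | forall w, C w -> B x w = 0].

Lemma mvn_equiv_perp (P Q : lend V) : P ^+ 2 = P -> Q ^+ 2 = Q ->
  mvn_equiv P Q <->
  submod_iso (form_perp (kernel P)) (form_perp (kernel Q)).
Proof.
move=> PP QQ; have [adj adjE] := adjointP.
have adjM T U : adj (T * U) = adj U * adj T.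
  by apply/lendP => x; apply: form_inj => y; rewrite !adjE.
have adjK T : adj (adj T) = T.
  apply/lendP => x; apply: form_inj => y.
  by rewrite adjE Bsym adjE Bsym.
have adj2 T : T ^+ 2 = T -> adj T ^+ 2 = adj T.
  by move=> TT; rewrite expr2 -adjM -expr2 TT.
have perpE T : T ^+ 2 = T -> form_perp (kernel T) = range (adj T).
  move=> TT; apply/seteqP; split=> [x Sx|_ [x _ <-] w Tw].
    apply/(idem_range _ (adj2 _ TT)); apply: form_inj => y.
    (* Split [y] as [(y - T y) + T y]: [x] is orthogonal to the first summand. *)
    have TyK : kernel T (y - T y).
      rewrite /kernel /= linearB /=; apply/eqP; rewrite subr_eq0; apply/eqP.
      by rewrite -[LHS](congr1 (fun U : lend V => U y) TT).
    have -> : B x y = B x (y - T y) + B x (T y).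
      by rewrite ![B x _]Bsym -BD subrK.
    by rewrite adjE (Sx _ TyK) add0r.
  by rewrite adjE Tw Bsym -[0](subrr 0) form_subr subrr.
rewrite !perpE // submod_iso_mvn; [|exact: adj2..].
(* Adjoints reverse products, so the two witnesses swap roles; the converse applies this to [adj P]
   and [adj Q]. *)
have mvnA T U : mvn_equiv T U -> mvn_equiv (adj T) (adj U).
  by case=> a [b [-> ->]]; exists (adj b), (adj a); rewrite !adjM.
by split=> [/mvnA //|/mvnA]; rewrite !adjK.
Qed.

End Adjoint.

(** * Representation of linear forms in finite dimension *)

Section Representation.
Variables (F : fieldType) (V : vectType F).

(** The map [phi] from [x] to the values of [B x] on a basis is injective by nondegeneracy, hence
    onto since the dimensions agree; a preimage of the values of [f] represents [f]. *)
Lemma form_represents (B : V -> V -> F) :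
    (forall y, scalar (B^~ y)) -> (forall x, scalar (B x)) ->
    (forall x, (forall y, B x y = 0) -> x = 0) ->
  forall f : V -> F, scalar f -> exists x, forall y, B x y = f y.
Proof.
move=> Bl Br Bnd f fl.
pose e := vbasis {:V}; pose n := \dim {:V}.
have ext (g h : V -> F) : scalar g -> scalar h ->
    (forall i : 'I_n, g e`_i = h e`_i) -> g =1 h.
  move=> gl hl gh y.
  have sE (k : V -> F) : scalar k -> k y = \sum_i coord e i y * k e`_i.
    move=> kl; pose kL : {scalar V} :=
      HB.pack k (GRing.isLinear.Build F V F *%R k kl).
    rewrite {1}(coord_vbasis (memvf y)) -[k]/(kL : V -> F) linear_sum.
    by apply: eq_bigr => i _; rewrite linearZ.
  by rewrite !sE //; apply: eq_bigr => i _; rewrite gh.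
pose phi0 x : 'rV[F]_n := \row_i B x e`_i.
have phil : linear phi0.
  by move=> c x y; apply/rowP => i; rewrite !mxE Bl.
pose phi : 'Hom(V, 'rV[F]_n) := linfun
  (HB.pack_for {linear V -> 'rV[F]_n} phi0
     (GRing.isLinear.Build F V 'rV[F]_n *:%R phi0 phil)).
have phiE x : phi x = phi0 x by rewrite lfunE.
have ker0 : lker phi = 0%VS.
  apply/eqP/lker0P => x y /eqP; rewrite -subr_eq0 -linearB /= phiE => /eqP xy.
  apply/eqP; rewrite -subr_eq0; apply/eqP/Bnd.
  apply: (ext _ (fun=> 0)) => [//|c u v|i]; first by rewrite mulr0 addr0.
  by move/rowP/(_ i): xy; rewrite !mxE.
have full : limg phi = fullv.
  apply/eqP; rewrite -(dimv_leqif_eq (subvf _)) limg_dim_eq ?ker0 ?capv0 //.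
  by rewrite [X in _ == X]dimvf dim_matrix mul1r.
have /memv_imgP[x _ xE] : \row_i f e`_i \in limg phi by rewrite full memvf.
exists x; apply: ext => // i.
by move/rowP/(_ i): xE; rewrite phiE !mxE.
Qed.

End Representation.

(** * Trace and conjugation in a finite field extension *)

Section Trace.
Variables (F : finFieldType) (K : fieldExtType F).
Local Notation L := (FinSplittingFieldType F K).

(** [fbar] iterates the Frobenius generator of the Galois group; its additivity, [F]-linearity and
    trace invariance follow from this. *)
Lemma fbar_gal : exists2 g : gal_of {:L}, g \in 'Gal({:L} / 1)%g &
  forall a : K, fbar a = g a.
Proof.
have [alpha gen alphaE] := @finField_galois_generator F L 1%AS {:L}%AS (sub1v _).
have galA : alpha \in 'Gal({:L} / 1)%g.
  by move: gen => /eqP->; exact: cycle_id.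
exists (alpha ^+ (\dim {:K})./2)%g; first exact: groupX.
move=> a; rewrite /fbar; elim: _./2 => [|n IHn].
  by rewrite expn0 expr1 gal_id.
rewrite expnSr exprM IHn expgSr galM ?memvf // alphaE ?memvf //=.
by rewrite dimv1 expn1.
Qed.

Lemma fbarD : {morph @fbar F K : a b / a + b}.
Proof. by have [g _ gE] := fbar_gal => a b; rewrite !gE rmorphD. Qed.

Lemma fbarZ (c : F) (a : K) : fbar (c *: a) = c *: fbar a.
Proof. by have [g _ gE] := fbar_gal; rewrite !gE linearZ. Qed.

Lemma fbarM : {morph @fbar F K : a b / a * b}.
Proof. by move=> a b; rewrite /fbar exprMn. Qed.

Lemma fieldTr_fbar (a : K) : fieldTr (fbar a) = fieldTr a.
Proof.
have [g galg ->] := fbar_gal.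
exact: (@galTrace_gal F L 1%AS {:L}%AS a g (memvf _) galg).
Qed.

(** For even degree, applying [fbar] twice raises to the power of the order of [K], which fixes
    every element. *)
Lemma fbarK : ~~ odd (\dim {:K}) -> involutive (@fbar F K).
Proof.
move=> ev a; rewrite /fbar -exprM -expnD addnn.
rewrite (even_halfK ev); apply/eqP.
by rewrite -(@Fermat's_little_theorem F K {:K}%AS) memvf.
Qed.

(** Independence of characters: the sum of all Galois automorphisms, with coefficients 1, is not the
    zero map. *)
Lemma fieldTr_neq0 : exists a : K, fieldTr a != 0.
Proof.
have [|a _] := @gal_independent_contra F L {:L}%AS
  (mem 'Gal({:L} / 1)%g) (fun=> 1) 1%g (group1 _); first exact: oner_neq0.
under eq_bigr do rewrite mul1r.
by exists a.
Qed.

End Trace.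

(** * The trace forms on the group algebra *)

Section TraceForm.
Variables (F : finFieldType) (K : fieldExtType F) (gT : finGroupType).
Variable s : duality.
Hypothesis even_TH : s = TH -> ~~ odd (\dim {:K}).
Local Notation FG := (grpalg F gT).
Local Notation KG := (grpalg K gT).

(** Lets both dualities be handled as a single sesquilinear form. *)
Definition duality_conj (a : K) : K := if s is TH then fbar a else a.
Local Notation conj := duality_conj.

Lemma duality_conjD : {morph conj : a b / a + b}.
Proof. by rewrite /conj; case: (s) => // a b; exact: fbarD. Qed.

Lemma duality_conjM : {morph conj : a b / a * b}.
Proof. by rewrite /conj; case: (s) => // a b; exact: fbarM. Qed.

Lemma duality_conjZ (c : F) a : conj (c *: a) = c *: conj a.
Proof. by rewrite /conj; case: (s) => //; exact: fbarZ. Qed.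

Lemma duality_conj0 : conj 0 = 0.
Proof. by rewrite -(scale0r (0 : K)) duality_conjZ !scale0r. Qed.

Lemma duality_conjK : involutive conj.
Proof.
by rewrite /conj; case: (s) even_TH => // ev a; apply: fbarK; apply: ev.
Qed.

Lemma fieldTr_conj a : fieldTr (conj a) = fieldTr a.
Proof. by rewrite /conj; case: (s) => //; exact: fieldTr_fbar. Qed.

Lemma trform_conj (x y : KG) :
  trform s x y = fieldTr (\sum_(g : gT) x g * conj (y g)).
Proof. by rewrite trformE /conj; case: (s). Qed.

Lemma trformDl (x y z : KG) : trform s (x + y) z = trform s x z + trform s y z.
Proof.
rewrite !trform_conj -raddfD -big_split /=; congr fieldTr.
by apply: eq_bigr => g _; rewrite ffunE mulrDl.
Qed.

Lemma trform_sym (x y : KG) : trform s x y = trform s y x.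
Proof.
rewrite !trform_conj -fieldTr_conj; congr fieldTr.
rewrite (big_morph conj duality_conjD duality_conj0).
by apply: eq_bigr => g _; rewrite duality_conjM duality_conjK mulrC.
Qed.

Lemma trform_nondegenerate (x : KG) : (forall y, trform s x y = 0) -> x = 0.
Proof.
move=> x0; apply/ffunP => g; rewrite ffunE; apply/eqP/negPn/negP => nxg.
have [a] := fieldTr_neq0 F K.
(* This vector is supported at [g] and pairs with [x] to [fieldTr a]. *)
have := x0 [ffun h => if h == g then conj ((x g)^-1 * a) else 0].
rewrite trform_conj (bigD1 g) //= ffunE eqxx duality_conjK mulVKf //.
rewrite big1 ?addr0 => [-> /eqP //|h /negPf nh].
by rewrite ffunE nh duality_conj0 mulr0.
Qed.

Lemma grpalg_scaleE (a : FG) (x : KG) g :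
  (a *: x) g = \sum_h a h *: x (h^-1 * g)%g.
Proof. by rewrite ffunE; apply: eq_bigr => h _; rewrite ffunE mulr_algl. Qed.

Definition antipode (a : FG) : FG := [ffun g => a g^-1%g].

(** Left translation by a group element preserves the form, so its adjoint is translation by the
    inverse. *)
Lemma trform_antipode (a : FG) (x y : KG) :
  trform s (a *: x) y = trform s x (antipode a *: y).
Proof.
rewrite !trform_conj; congr fieldTr.
under eq_bigr => g _ do rewrite grpalg_scaleE mulr_suml.
under [RHS]eq_bigr => g _ do
  rewrite grpalg_scaleE (big_morph conj duality_conjD duality_conj0) mulr_sumr.
rewrite exchange_big [RHS]exchange_big (reindex_inj invg_inj) /=.
apply: eq_bigr => h _; rewrite (reindex_inj (mulgI h^-1%g)) /=.
apply: eq_bigr => g _.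
by rewrite invgK mulKVg ffunE duality_conjZ -scalerAl -scalerAr.
Qed.

(** Scalars of [F] sit in [FG] at the identity; hence [FG]-linear maps are [F]-linear. *)
Lemma grpalg_scale_const (c : F) (x : KG) :
  ([ffun g => c *+ (g == 1%g)] : FG) *: x = [ffun g => c *: x g].
Proof.
apply/ffunP => g; rewrite grpalg_scaleE (bigD1 1%g) //= !ffunE eqxx.
rewrite invg1 mul1g big1 ?addr0 // => h /negPf nh.
by rewrite ffunE nh scale0r.
Qed.

Lemma trformZl (c : F) (x y : KG) :
  trform s [ffun g => c *: x g] y = c *: trform s x y.
Proof.
rewrite !trform_conj -fieldTrZ scaler_sumr; congr fieldTr.
by apply: eq_bigr => g _; rewrite ffunE -scalerAl.
Qed.

(** Reads a trace value, which lies in the copy of [F] inside [K], as an element of [F]. *)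
Definition base_coord : K -> F := coord [tuple (1 : K)] ord0.

Lemma trform_base_coord (x y : KG) :
  trform s x y = (base_coord (trform s x y))%:A.
Proof.
have : trform s x y \in <<[tuple (1%R : K)]>>%VS.
  by rewrite span_seq1 trformE; apply: fieldTr_in_base.
by move/coord_span; rewrite big_ord1.
Qed.

Lemma trform_adjoint (P : @lend FG KG) (x : KG) :
  exists z, forall y, trform s z y = trform s x (P y).
Proof.
(* [V] is [KG] seen as an [F]-space, where the linear form sending [y] to [B x (P y)] can be
   represented. *)
pose V : vectType F := {ffun gT -> K}.
pose B (u v : V) := base_coord (trform s (u : KG) (v : KG)).
have scaleE (c : F) (u : V) : c *: u = [ffun g => c *: u g].
  by apply/ffunP => g; rewrite !ffunE.
have Bl v : scalar (B^~ v).
  by move=> c u w; rewrite /B scaleE trformDl trformZl /base_coord linearP.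
have Bsym u v : B u v = B v u by rewrite /B trform_sym.
have Br u : scalar (B u) by move=> c v w; rewrite !(Bsym u) Bl.
have Bnd u : (forall v, B u v = 0) -> u = 0.
  move=> u0; apply: trform_nondegenerate => v.
  by rewrite trform_base_coord [base_coord _]u0 scale0r.
have [|z zE] := form_represents F V B Bl Br Bnd (fun y => B x (P y)).
  move=> c u v; have -> : P (c *: u + v) = c *: (P u : V) + P v :> V.
    by rewrite !scaleE -!grpalg_scale_const linearP.
  exact: Br.
by exists z => y; rewrite trform_base_coord [base_coord _]zE -trform_base_coord.
Qed.

End TraceForm.

Theorem corollary3p38 (F : finFieldType) (K : fieldExtType F)
    (gT : finGroupType) (s : duality) (C D : set (grpalg K gT))
    (P Q : @lend (grpalg F gT) (grpalg K gT)) :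
  (s = TH -> ~~ odd (\dim {:K})) ->
  P ^+ 2 = P -> Q ^+ 2 = Q ->
  C = range P -> D = range Q ->
  [<-> @submod_iso (grpalg F gT) (grpalg K gT) C D;
       mvn_equiv P Q;
       @submod_iso (grpalg F gT) (grpalg K gT)
         (perp s (kernel P)) (perp s (kernel Q))].
Proof.
move=> ev PP QQ -> ->.
have iso_mvn := submod_iso_mvn P Q PP QQ.
(* Here [star] is [antipode], and [form_perp] for [trform s] unfolds to the same set as [perp s]. *)
have mvn_perp := mvn_equiv_perp _ _ (trformDl F K gT s) (trform_sym F K gT s ev)
  (trform_nondegenerate F K gT s ev) (trform_antipode F K gT s)
  (trform_adjoint F K gT s ev) P Q PP QQ.
by tfae=> [/iso_mvn|/mvn_perp|/mvn_perp/iso_mvn].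
Qed.
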